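(* Let $G \in \mathbf{R}\mathbf{H}_\infty^{m\times n}$ and $K \in \mathbf{R}\mathbf{H}_\infty^{n\times m}$. Suppose there exist $N \in \mathbf{L}_\infty^{n\times n}$ and $M \in \mathbf{L}_\infty^{m\times m}$ such that for all $\omega \in [0,\infty]$, $N(j\omega) = N(j\omega)^* \preceq 0$, $M(j\omega) = M(j\omega)^* \succeq 0$, and $$\begin{bmatrix} I & -G(j\omega)^* \end{bmatrix} \Pi(j\omega) \begin{bmatrix} I \\ -G(j\omega) \end{bmatrix} \prec 0 \quad\text{and}\quad \begin{bmatrix} K(j\omega)^* & I \end{bmatrix} \Pi(j\omega) \begin{bmatrix} K(j\omega) \\ I \end{bmatrix} \succeq 0,$$ where $$\Pi := \begin{bmatrix} N & 0 \\ 0 & M \end{bmatrix}.$$ Then $(I + uGK)^{-1} \in \mathbf{R}\mathbf{H}_\infty^{m\times m}$ for all unitary $u \in \mathbf{R}\mathbf{H}_\infty^{1\times 1}$.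
   Context: $j^2=-1$; $\cdot^*$ is the conjugate transpose; $\prec,\preceq,\succeq$ denote the Loewner order. $\mathbf{L}_\infty^{m\times n}$ is the space of functions $\phi: j\mathbb{R} \to \mathbb{C}^{m\times n}$ with $\operatorname{ess\,sup}_{\omega\in\mathbb{R}} \|\phi(j\omega)\|_2 < \infty$ ($\|\cdot\|_2$ the matrix 2-norm). $\mathbf{R}\mathbf{H}_\infty^{m\times n}$ is the set of $m\times n$ real-rational proper transfer function matrices with no poles in the closed right-half complex plane. $U\in\mathbf{R}\mathbf{H}_\infty^{n\times n}$ is called unitary if $U(j\omega)$ is a unitary matrix for all $\omega\in[0,\infty]$. $G(j\infty)$ denotes the limit of $G(j\omega)$ as $\omega\to\infty$; multipliers in $\mathbf{L}_\infty$ are understood as functions with a specified value at every $\omega\in[0,\infty]$. *)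

(* Defs.v *)
From HB Require Import structures.
From mathcomp Require Import all_boot all_order all_algebra.
From mathcomp Require Import generic_quotient fraction spectral sesquilinear.
From mathcomp Require Import complex.
From mathcomp Require Import all_classical all_reals all_analysis.
From mathcomp Require Import ess_sup_inf.

Set Implicit Arguments.
Unset Strict Implicit.
Unset Printing Implicit Defensive.

Import Order.TTheory GRing.Theory Num.Theory.
Import numFieldNormedType.Exports.

Local Open Scope classical_set_scope.
Local Open Scope ring_scope.
Local Open Scope complex_scope.
Local Open Scope sesquilinear_scope.

Section RationalFunctions.
Variable R : realType.
Implicit Types (f : {fraction {poly R}}) (s : R[i]).

(* [repr f] need not be in lowest terms, hence the division by the gcd; the
   three lemmas below characterize the result. *)
Definition rf_num f : {poly R} :=
  (repr f).1 %/ gcdp (repr f).1 (repr f).2.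

Definition rf_den f : {poly R} :=
  (repr f).2 %/ gcdp (repr f).1 (repr f).2.

Lemma rf_den_neq0 f : rf_den f != 0.
Proof.
by rewrite /rf_den dvdp_div_eq0 ?dvdp_gcdr//; exact: denom_ratioP.
Qed.

Lemma rf_coprime f : coprimep (rf_num f) (rf_den f).
Proof. by apply: coprimep_div_gcd; rewrite denom_ratioP orbT. Qed.

Lemma rf_numdenE f : f = tofrac (rf_num f) / tofrac (rf_den f).
Proof.
have piE (x : {ratio {poly R}}) :
    (\pi x)%qT = tofrac x.1 / tofrac x.2 :> {fraction {poly R}}.
  have x2 := denom_ratioP x.
  apply/(mulIf (x := tofrac x.2)); first by rewrite tofrac_eq0.
  rewrite mulfVK ?tofrac_eq0//.
  rewrite !piE; apply/eqmodP; rewrite /= /FracField.equivf /FracField.mulf.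
  by rewrite !numden_Ratio ?mulf_neq0 ?oner_neq0// !mulr1 mulrC.
rewrite -[LHS]reprK piE.
set x := repr f; set g := gcdp x.1 x.2.
have d0 : x.2 != 0 := denom_ratioP x.
have g0 : g != 0 by rewrite gcdp_eq0 negb_and d0 orbT.
have nE : x.1 = rf_num f * g by rewrite divpK ?dvdp_gcdl.
have dE : x.2 = rf_den f * g by rewrite divpK ?dvdp_gcdr.
by rewrite nE dE !tofracM -mulf_div divff ?mulr1// tofrac_eq0.
Qed.

Definition cpoly (p : {poly R}) : {poly R[i]} := map_poly (real_complex R) p.

Definition rf_eval f s : R[i] :=
  (cpoly (rf_num f)).[s] / (cpoly (rf_den f)).[s].

Definition rf_proper f : Prop := (size (rf_num f) <= size (rf_den f))%N.

(* The poles are the complex roots of the reduced denominator. *)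
Definition rf_pole f s : Prop := root (cpoly (rf_den f)) s.

(* Value at jw. [R[i]^o] is [R[i]] with the topology of its modulus, in which
   the values at infinity are limits along the imaginary axis. *)
Definition rf_freq f (w : \bar R) : R[i] :=
  match w with
  | r%:E => rf_eval f (0 +i* r)
  | +oo%E => lim ((rf_eval f (0 +i* r) : R[i]^o) @[r --> +oo%R])
  | -oo%E => lim ((rf_eval f (0 +i* r) : R[i]^o) @[r --> -oo%R])
  end.

End RationalFunctions.

Section TransferMatrices.
Variable R : realType.

Definition RHinf m n (G : 'M[{fraction {poly R}}]_(m, n)) : Prop :=
  forall i j, rf_proper (G i j) /\
    forall s : R[i], 0 <= complex.Re s -> ~ rf_pole (G i j) s.

Definition freq m n (G : 'M[{fraction {poly R}}]_(m, n)) (w : \bar R) :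
  'M[R[i]]_(m, n) := map_mx (fun f => rf_freq f w) G.

Definition unitary_RHinf n (U : 'M[{fraction {poly R}}]_n) : Prop :=
  RHinf U /\ forall w : \bar R, (0 <= w)%E -> freq U w \is unitarymx.

End TransferMatrices.

Section ComplexMatrices.
Variable R : realType.

Definition vnorm n (x : 'cV[R[i]]_n) : R :=
  Num.sqrt (\sum_i Normc.normc (x i 0) ^+ 2).

Definition mxnorm2 m n (A : 'M[R[i]]_(m, n)) : R :=
  sup [set vnorm (A *m x) | x in [set x : 'cV[R[i]]_n | vnorm x <= 1]].

(* [phi w] is the value at jw; [phi +oo] is the value specified at j*oo, which
   the essential supremum over the reals ignores, and [phi -oo] is unused. *)
Definition Linf m n (phi : \bar R -> 'M[R[i]]_(m, n)) : Prop :=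
  (ess_sup (@lebesgue_measure R) (fun w : R => (mxnorm2 (phi w%:E))%:E) < +oo)%E.

Definition psdmx n (A : 'M[R[i]]_n) : Prop :=
  A \is hermsymmx /\ forall x : 'cV[R[i]]_n, 0 <= (x ^t* *m A *m x) 0 0.

Definition pdmx n (A : 'M[R[i]]_n) : Prop :=
  A \is hermsymmx /\
  forall x : 'cV[R[i]]_n, x != 0 -> 0 < (x ^t* *m A *m x) 0 0.

Definition loewner_le n (A B : 'M[R[i]]_n) : Prop := psdmx (B - A).

Definition loewner_lt n (A B : 'M[R[i]]_n) : Prop := pdmx (B - A).

End ComplexMatrices.

(* Main.v *)
Require Import Defs.
From HB Require Import structures.
From mathcomp Require Import all_boot all_order all_algebra.
From mathcomp Require Import fraction spectral sesquilinear.
From mathcomp Require Import complex.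
From mathcomp Require Import zify ring lra.
From mathcomp Require Import all_classical all_reals all_analysis.

Set Implicit Arguments.
Unset Strict Implicit.
Unset Printing Implicit Defensive.

Import Order.TTheory GRing.Theory Num.Theory.

Local Open Scope ring_scope.
Local Open Scope complex_scope.
Local Open Scope sesquilinear_scope.

(** The multipliers separate the graph of [- G] from the inverse graph of [K] at
    every frequency of the closed upper half of the imaginary axis. If
    [x = - z G K x] with [|z| <= 1] and [x] nonzero, put [y = K x]; the strict
    inequality tested at [y], together with [M >= 0], gives
    [x^* M x = |z|^2 (G y)^* M (G y) <= (G y)^* M (G y) < - y^* N y], and the
    other one, tested at [x], gives [- y^* N y <= x^* M x]: a contradiction.
    Hence [det (1 + z G K)] does not vanish there ([separation_det_neq0]). Since
    [|u| = 1] on the axis, [det (1 + t u G K)] is nonzero for all [t] in [0, 1]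
    and all frequencies, infinity included.

    The passage from the axis to the closed right half-plane is a homotopy in
    [t], carried out on polynomials. The proper fractions without poles in
    the closed right half-plane form a ring ([stable_closed]), so the
    coefficients of the polynomial [det (1 + X u G K)] in [X] have a common
    denominator [d] without zeros in that half-plane, and
    [det (1 + t u G K) = Q_t / d] with [Q_t] a real polynomial, [Q_0 = d] and
    [deg Q_t <= deg d] ([common_denominator]). The value at infinite frequency is
    the quotient of the coefficients of degree [deg d]; as it is nonzero,
    [deg Q_t = deg d] for every [t]. No root of [Q_t] can then cross the axis or
    escape to infinity, so [Q_1], like [Q_0], has no root in the closed right
    half-plane ([hurwitz_homotopy]). The inverse of [L = 1 + u G K] is its
    adjugate, whose entries are stable, multiplied by [d / Q_1], which is
    stable too ([invmx_RHinf]). *)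

(** * Separation by multipliers at one frequency *)

Section Multipliers.
Variables (R : realType) (m n : nat).
Implicit Types (N : 'M[R[i]]_n) (M : 'M[R[i]]_m).

Let qform k (A : 'M[R[i]]_k) (x : 'cV_k) : R[i] := (x ^t* *m A *m x) 0 0.

Let adjmxM k l p (A : 'M[R[i]]_(k, l)) (B : 'M[R[i]]_(l, p)) :
  (A *m B) ^t* = B ^t* *m A ^t*.
Proof. by rewrite trmx_mul map_mxM. Qed.

Let qform_congr k l (A : 'M[R[i]]_(k, l)) (B : 'M[R[i]]_k) (x : 'cV_l) :
  qform (A ^t* *m B *m A) x = qform B (A *m x).
Proof. by rewrite /qform adjmxM !mulmxA. Qed.

Let qformD k (A B : 'M[R[i]]_k) x : qform (A + B) x = qform A x + qform B x.
Proof. by rewrite /qform mulmxDr mulmxDl mxE. Qed.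

(** The factor [t] only multiplies the quadratic form of [M] by [|t|^2 <= 1], so a
    single pair of multipliers serves the whole unit disk; this is what makes the
    homotopy possible. *)
Lemma separation_det_neq0 N M (G : 'M[R[i]]_(m, n)) (K : 'M[R[i]]_(n, m)) :
  let Pi := block_mx N 0 0 M in
  loewner_le 0 M ->
  loewner_lt (row_mx 1%:M (- G ^t*) *m Pi *m col_mx 1%:M (- G)) 0 ->
  loewner_le 0 (row_mx (K ^t*) 1%:M *m Pi *m col_mx K 1%:M) ->
  forall t : R[i], `|t| <= 1 -> \det (1%:M + t *: (G *m K)) != 0.
Proof.
move=> Pi [_ M_ge0] [_ GPi_lt0] [_ KPi_ge0] t t_le1.
rewrite -det_tr; apply/negP => /det0P[v v_neq0 vL].
pose x := v^T; pose y := K *m x; pose z := G *m y.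
have x_neq0 : x != 0 by apply: contraNneq v_neq0 => x0; rewrite -[v]trmxK -/x x0 trmx0.
have xE : x = - t *: z.
  apply/eqP; rewrite scaleNr -addr_eq0; apply/eqP.
  have := congr1 trmx vL; rewrite trmx_mul trmxK trmx0 -/x.
  by rewrite mulmxDl mul1mx -scalemxAl -mulmxA.
have y_neq0 : y != 0.
  by apply: contraNneq x_neq0 => y0; rewrite xE /z y0 mulmx0 scaler0.
have Ny_lt : qform N y + qform M z < 0.
  have := GPi_lt0 y y_neq0.
  rewrite mul_row_block mul_row_col !mulmx0 addr0 !mul1mx mulmx1.
  rewrite !add0r mulmxN !mulNmx mulmxN opprK mxE oppr_gt0.
  by rewrite -[X in X < 0]/(qform _ y) qformD qform_congr.
have Ny_ge : 0 <= qform N y + qform M x.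
  have := KPi_ge0 x.
  rewrite mul_row_block mul_row_col !mulmx0 addr0 add0r !mul1mx mulmx1 subr0.
  by rewrite -[X in 0 <= X]/(qform _ x) qformD qform_congr.
have MxE : qform M x = `|t| ^+ 2 * qform M z.
  have xsE : x ^t* = (- t)^* *: z ^t* by rewrite xE linearZ /= map_mxZ.
  rewrite /qform xsE xE -scalemxAl -scalemxAl -scalemxAr scalerA mxE.
  by rewrite -(normrN t) normCKC.
have Mz_ge0 : 0 <= qform M z by have := M_ge0 z; rewrite subr0.
have: qform M x <= qform M z.
  by rewrite MxE ler_piMl// exprn_ile1.
rewrite -(lerD2l (qform N y)) => le_xz.
by have := le_lt_trans (le_trans Ny_ge le_xz) Ny_lt; rewrite ltxx.
Qed.
End Multipliers.

(** * Zero exclusion for Hurwitz polynomials *)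

(** Connectedness of the unit interval in the form used by the homotopy: the
    supremum of the points up to which [T] holds can only be 1. *)
Lemma unit_interval_connected (R : realType) (T : R -> Prop) :
  (forall s, 0 <= s <= 1 -> exists2 e, 0 < e &
     forall t, 0 <= t <= 1 -> `|t - s| < e -> (T s <-> T t)) ->
  T 0 -> T 1.
Proof.
move=> Tloc T0.
pose A : set R := [set x | 0 <= x <= 1 /\ forall y, 0 <= y <= x -> T y]%classic.
have A0 : A 0.
  by split=> [|y y0]; [rewrite lexx ler01|rewrite (_ : y = 0)//; lra].
have ubA : ubound A 1 by move=> x [/andP[]].
have supA : has_sup A by split; [exists 0|exists 1].
have s0 : 0 <= sup A by apply: ub_le_sup => //; case: supA.
have s1 : sup A <= 1 by apply: ge_sup => //; exists 0.
have s01 : 0 <= sup A <= 1 by rewrite s0.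
have [e e0 se] := Tloc _ s01.
have [a [a01 Ta] sa] := sup_adherent e0 supA.
have as_ : a <= sup A by apply: ub_le_sup => //; case: supA.
have Ts : T (sup A).
  have /andP[a0 a1] := a01.
  by apply/(se a) => //; [rewrite ler0_norm; lra|apply: Ta; rewrite a0 lexx].
have Tnear y : 0 <= y <= 1 -> y < sup A + e -> T y.
  move=> y01 ye; have [ya|ay] := leP y a; first by apply: Ta; lra.
  by apply/(se y) => //; rewrite ltr_norml; lra.
have [s1'|/eqP s1'] := eqVneq (sup A) 1; first by rewrite -s1'.
pose b := Num.min 1 (sup A + e / 2).
have bs : sup A < b by rewrite /b lt_min; lra.
have be : b < sup A + e by rewrite /b gt_min; apply/orP; right; lra.
have b1 : b <= 1 by rewrite /b ge_min lexx.
have Ab : A b.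
  by split=> [|y /andP[y0 yb]]; [lra|apply: Tnear; lra].
by have := ub_le_sup (proj2 supA) Ab; lra.
Qed.

Section Hurwitz.
Variable R : realType.
Implicit Types (p q : {poly R}) (z : R[i]).
Import Normc.

Definition hurwitz p := forall z, 0 <= complex.Re z -> ~~ root (cpoly p) z.

Lemma normc_ge0 z : 0 <= normc z.
Proof. by case: z => a b; exact: sqrtr_ge0. Qed.

Lemma normcR (a : R) : normc a%:C = `|a|.
Proof. by rewrite /= expr0n/= addr0 sqrtr_sqr. Qed.

Lemma normcX z k : normc (z ^+ k) = normc z ^+ k.
Proof. by elim: k => [|k IH]; rewrite ?expr0 ?normc1// !exprS normcM IH. Qed.

Lemma normc_sum I (r : seq I) (F : I -> R[i]) :
  normc (\sum_(i <- r) F i) <= \sum_(i <- r) normc (F i).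
Proof.
elim: r => [|i r IH]; rewrite ?big_nil ?normc0// !big_cons.
by apply: le_trans (le_normcD _ _) _; rewrite lerD2l.
Qed.

Lemma Re_le_normc z : complex.Re z <= normc z.
Proof.
case: z => a b /=; apply: le_trans (ler_norm a) _.
by rewrite -sqrtr_sqr ler_wsqrtr// lerDl sqr_ge0.
Qed.

Lemma cpoly_lead p : lead_coef (cpoly p) = (lead_coef p)%:C.
Proof. by rewrite /cpoly lead_coef_map. Qed.

Lemma cpoly_roots p : {rs : seq R[i] |
  [/\ cpoly p = (lead_coef p)%:C *: \prod_(r <- rs) ('X - r%:P),
      p != 0 -> size p = (size rs).+1
    & p != 0 -> forall r, (r \in rs) = root (cpoly p) r]}.
Proof.
have [rs prs] := closed_field_poly_normal (cpoly p).
rewrite cpoly_lead in prs; exists rs; split=> //.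
  move=> p0; rewrite -(size_map_poly (real_complex R) p) -/(cpoly p) prs size_scale.
    by rewrite size_prod_XsubC.
  by rewrite -[0]/(0%:C) (inj_eq (@complexI _)) lead_coef_eq0.
move=> p0 r; rewrite prs rootZ ?root_prod_XsubC//.
by rewrite -[0]/(0%:C) (inj_eq (@complexI _)) lead_coef_eq0.
Qed.

(** The distance from [z] to [r] is at least [- Re r] and at least
    [|z| - |r|]; combining the two gives a bound that grows with [z]. *)
Lemma left_root_bound (r : R[i]) : complex.Re r < 0 ->
  exists2 c, 0 < c & forall z, 0 <= complex.Re z ->
    c * (1 + normc z) <= normc (z - r).
Proof.
move=> r0; set a := complex.Re r in r0.
have nr := normc_ge0 r.
(* If [m = |z - r|], then [- a <= m] and [|z| <= m + |r|], so that
   [- a * (1 + |z|) <= - a * m - a * (1 + |r|) <= m * (1 + |r| - a)]. *)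
exists (- a / (1 + normc r - a)); first by rewrite divr_gt0; lra.
move=> z z0; have nzr : - a <= normc (z - r).
  apply: le_trans (Re_le_normc _).
  rewrite (_ : complex.Re (z - r) = complex.Re z - a); first by lra.
  by case: (z) (r) @a {r0} => ? ? [].
have nz : normc z <= normc (z - r) + normc r.
  by rewrite -[X in normc X <= _](subrK r); exact: le_normcD.
rewrite mulrAC ler_pdivrMr; last by lra.
nra.
Qed.

Lemma left_roots_bound (rs : seq R[i]) :
  (forall r, r \in rs -> complex.Re r < 0) ->
  exists2 c, 0 < c & forall z, 0 <= complex.Re z ->
    c * (1 + normc z) ^+ size rs <= normc (\prod_(r <- rs) (z - r)).
Proof.
elim: rs => [|r rs IH] rs0.
  by exists 1 => // z z0; rewrite big_nil normc1 mulr1.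
have [|c c0 cb] := IH; first by move=> s srs; apply: rs0; rewrite inE srs orbT.
have [|b b0 bb] := @left_root_bound r; first by apply: rs0; rewrite mem_head.
exists (b * c) => [|z z0]; first exact: mulr_gt0.
rewrite big_cons normcM /= exprS mulrACA.
have z1 : 0 <= 1 + normc z by have := normc_ge0 z; lra.
apply: ler_pM; [| |exact: bb|exact: cb].
  by rewrite mulr_ge0// ltW.
by rewrite mulr_ge0 ?exprn_ge0// ltW.
Qed.

Lemma hurwitz_roots p : hurwitz p -> p != 0 -> exists rs,
  [/\ size rs = (size p).-1, forall r, r \in rs -> complex.Re r < 0
    & forall z, normc (cpoly p).[z] =
                `|lead_coef p| * normc (\prod_(r <- rs) (z - r))].
Proof.
move=> hp p0; have [rs [prs sz rootE]] := cpoly_roots p.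
exists rs; split=> [|r|z]; first by rewrite sz.
  rewrite rootE// => pr; rewrite ltNge; apply/negP => r0.
  by have := hp _ r0; rewrite pr.
rewrite {1}prs hornerZ normcM normcR horner_prod.
by congr (_ * normc _); apply: eq_bigr => r _; rewrite !hornerE.
Qed.

Lemma hurwitz_neq0 p : hurwitz p -> p != 0.
Proof.
move=> /(_ 0 (lexx 0)); apply: contraNneq => ->.
by rewrite /cpoly rmorph0 root0.
Qed.

(** This lower bound has the growth of a polynomial of the same degree, so it
    survives small perturbations of the coefficients, uniformly on the unbounded
    half-plane: the Hurwitz polynomials of a given degree form an open set. *)
Lemma hurwitz_bound p : hurwitz p -> exists2 c, 0 < c &
  forall z, 0 <= complex.Re z -> c * (1 + normc z) ^+ (size p).-1 <= normc (cpoly p).[z].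
Proof.
move=> hp; have p0 := hurwitz_neq0 hp.
have [rs [sz rs0 pE]] := hurwitz_roots hp p0.
have [c c0 cb] := left_roots_bound rs0.
have l0 : 0 < `|lead_coef p| by rewrite normr_gt0 lead_coef_eq0.
exists (`|lead_coef p| * c) => [|z z0]; first exact: mulr_gt0.
by rewrite pE -mulrA ler_pM2l// -sz cb.
Qed.

(** This bound depends on the polynomial through its degree and leading
    coefficient only, and hence passes to limits: a limit of Hurwitz
    polynomials of the same degree has no root in the open right half-plane. *)
Lemma hurwitz_lead_bound p z : hurwitz p -> 0 <= complex.Re z ->
  `|lead_coef p| * complex.Re z ^+ (size p).-1 <= normc (cpoly p).[z].
Proof.
move=> hp z0; have p0 := hurwitz_neq0 hp.
have [rs [<- rs0 ->]] := hurwitz_roots hp p0.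
rewrite ler_wpM2l//; elim: rs rs0 => [|r rs IH] rs0.
  by rewrite big_nil normc1 expr0.
rewrite big_cons normcM /= exprS ler_pM ?exprn_ge0//; last first.
  by apply: IH => s srs; apply: rs0; rewrite inE srs orbT.
apply: le_trans (Re_le_normc _).
have := rs0 r (mem_head _ _).
by case: (z) (r) => ? ? [] ? ? /=; lra.
Qed.

Lemma horner_coef_bound p D b z :
  (size p <= D.+1)%N -> (forall i, `|p`_i| <= b) ->
  normc (cpoly p).[z] <= b * D.+1%:R * (1 + normc z) ^+ D.
Proof.
move=> pD pb.
have z1 : 0 <= normc z := normc_ge0 z.
rewrite (@horner_coef_wide _ D.+1) ?size_map_poly//.
apply: le_trans (normc_sum _ _) _.
have -> : b * D.+1%:R * (1 + normc z) ^+ D =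
    \sum_(i < D.+1) b * (1 + normc z) ^+ D.
  by rewrite sumr_const card_ord -[RHS]mulr_natr mulrAC.
apply: ler_sum => i _; rewrite coef_map normcM normcR normcX.
rewrite ler_pM ?exprn_ge0//.
apply: (@le_trans _ _ ((1 + normc z) ^+ i)).
  by apply: lerXn2r; rewrite ?nnegrE; lra.
by rewrite ler_weXn2l ?leq_ord//; lra.
Qed.

Lemma cpoly_conj_root p z : root (cpoly p) z = root (cpoly p) (conjc z).
Proof.
rewrite -complex_root_conj; congr (root _ _).
rewrite /cpoly -map_poly_comp; apply: eq_map_poly => x /=.
by rewrite oppr0.
Qed.

(** Being Hurwitz is an open condition on [t] by [hurwitz_bound]. It is also a
    closed one: by [hurwitz_lead_bound] a limit of Hurwitz polynomials could only
    acquire roots on the imaginary axis, where there are none. Roots of real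
    polynomials come in conjugate pairs, which is why only the upper half of
    the axis has to be inspected. *)
Lemma hurwitz_homotopy (Q : R -> {poly R}) (D : nat) (b : R) :
  (forall i (s t : R), 0 <= s <= 1 -> 0 <= t <= 1 ->
     `|(Q t)`_i - (Q s)`_i| <= b * `|t - s|) ->
  (forall t : R, 0 <= t <= 1 -> size (Q t) = D.+1) ->
  (forall t w : R, 0 <= t <= 1 -> 0 <= w -> ~~ root (cpoly (Q t)) (0 +i* w)) ->
  hurwitz (Q 0) -> hurwitz (Q 1).
Proof.
move=> Qb Qsz Qaxis.
have b0 : 0 <= b.
  have := Qb 0%N 0 1; rewrite subr0 normr1 mulr1 !lexx ler01 => /(_ isT isT).
  exact: le_trans.
pose B := b * D.+1%:R.
have B0 : 0 <= B by rewrite mulr_ge0.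
have Qdist s t z : 0 <= s <= 1 -> 0 <= t <= 1 ->
    normc ((cpoly (Q t)).[z] - (cpoly (Q s)).[z]) <=
      B * `|t - s| * (1 + normc z) ^+ D.
  move=> s01 t01; rewrite -hornerN -hornerD -rmorphB /=.
  rewrite (_ : B * _ = b * `|t - s| * D.+1%:R); last by rewrite /B mulrAC.
  apply: horner_coef_bound => [|i]; last by rewrite coefB Qb.
  by rewrite (leq_trans (size_polyD _ _))// size_polyN !Qsz// maxnn.
apply: (@unit_interval_connected R (hurwitz \o Q)) => s s01 /=.
have [hs|nhs] := pselect (hurwitz (Q s)).
  have [c c0 cb] := hurwitz_bound hs; rewrite Qsz//= in cb.
  exists (c / (B + 1)) => [|t t01]; first by rewrite divr_gt0//; lra.
  rewrite ltr_pdivlMr ?mulrDr ?mulr1; last by lra.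
  move=> ts; split=> // _ z z0; apply/negP => /rootP tz.
  have := cb _ z0; have := Qdist s t z s01 t01.
  rewrite tz sub0r normcN => le1 /le_trans /(_ le1).
  rewrite ler_pM2r; last by rewrite exprn_gt0//; have := normc_ge0 z; lra.
  by have := normr_ge0 (t - s); nra.
have [z z0 sz] : exists2 z, 0 < complex.Re z & root (cpoly (Q s)) z.
  have /existsNP[z /not_implyP[z0 /negP/negPn sz]] := nhs.
  exists z => //; rewrite lt_neqAle z0 andbT; apply/eqP => Rez.
  case: z {z0} Rez sz => x y /= <-.
  have [y0|y0] := leP 0 y; first by apply/negP/Qaxis.
  rewrite cpoly_conj_root /=; apply/negP/Qaxis => //; lra.
pose r := complex.Re z ^+ D.
have r0 : 0 < r by rewrite exprn_gt0.
pose l := `|lead_coef (Q s)|.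
have l0 : 0 < l by rewrite normr_gt0 lead_coef_eq0 -size_poly_gt0 Qsz.
pose x := (1 + normc z) ^+ D.
have x0 : 0 < x by rewrite exprn_gt0//; have := normc_ge0 z; lra.
have k0 : 0 < B * x + b * r + 1.
  by rewrite ltr_wpDl// addr_ge0// mulr_ge0// ltW.
exists (l * r / (B * x + b * r + 1)) => [|t t01]; first by rewrite divr_gt0// mulr_gt0.
rewrite ltr_pdivlMr// => ts; split=> // ht; exfalso.
have := hurwitz_lead_bound ht (ltW z0); rewrite Qsz//= -/r.
have := Qdist s t z s01 t01; rewrite (rootP sz) subr0 -/x => le1 /le_trans/(_ le1).
have := Qb D s t s01 t01.
have -> : (Q t)`_D = lead_coef (Q t) by rewrite lead_coefE Qsz.
have -> : (Q s)`_D = lead_coef (Q s) by rewrite lead_coefE Qsz.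
have := lerB_dist (lead_coef (Q s)) (lead_coef (Q t)); rewrite distrC -/l => le3 le4 le5.
have le6 : (l - b * `|t - s|) * r <= `|lead_coef (Q t)| * r by rewrite ler_pM2r//; lra.
by have := normr_ge0 (t - s); nra.
Qed.

End Hurwitz.

(** * The ring of stable proper fractions and its frequency response *)

Section StableFractions.
Variable R : realType.
Implicit Types (p q d : {poly R}) (f g : {fraction {poly R}}).
Import numFieldNormedType.Exports.
Local Open Scope classical_set_scope.

(** The fraction [p / q] need not be reduced, which makes closure under the ring
    operations immediate; [stable_RHinf] relates this to the reduced
    representation. *)
Definition stable_frac f := exists p q,
  [/\ f = tofrac p / tofrac q, hurwitz q & (size p <= size q)%N].

Definition stable_pred : {pred {fraction {poly R}}} := fun f => `[< stable_frac f >].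

Lemma stableP f : reflect (stable_frac f) (f \in stable_pred).
Proof. exact: asboolP. Qed.

Lemma tofrac_eq_cross p q p' q' : q != 0 -> q' != 0 ->
  tofrac p / tofrac q = tofrac p' / tofrac q' -> p * q' = p' * q.
Proof.
move=> q0 q'0 e; apply/eqP; rewrite -tofrac_eq !tofracM.
by rewrite -eqr_div ?tofrac_eq0//; apply/eqP.
Qed.

Lemma cpolyM p q : cpoly (p * q) = cpoly p * cpoly q.
Proof. exact: rmorphM. Qed.

Lemma hurwitzM p q : hurwitz p -> hurwitz q -> hurwitz (p * q).
Proof. by move=> hp hq s s0; rewrite cpolyM rootM negb_or hp ?hq. Qed.

Lemma hurwitz_dvd p q : hurwitz q -> p %| q -> hurwitz p.
Proof.
move=> hq pq s s0; apply: contra (hq s s0) => /rootP ps.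
apply/rootP; rewrite -(divpK pq) cpolyM hornerM.
by rewrite ps mulr0.
Qed.

Lemma hurwitz1 : hurwitz (1 : {poly R}).
Proof. by move=> s _; rewrite /cpoly rmorph1 root1. Qed.

Lemma rf_den_dvd p q : q != 0 -> rf_den (tofrac p / tofrac q) %| q.
Proof.
move=> q0; set f := _ / _; have E := rf_numdenE f.
have := tofrac_eq_cross q0 (rf_den_neq0 f) E => {}E.
have cop : coprimep (rf_den f) (rf_num f) by rewrite coprimep_sym rf_coprime.
by rewrite -(Gauss_dvdpr q cop) -E dvdp_mull.
Qed.

Lemma size_mul_proper p q p' q' : q != 0 -> q' != 0 ->
  (size p <= size q)%N -> (size p' <= size q')%N -> (size (p * p')%R <= size (q * q')%R)%N.
Proof.
move=> q0 q'0 pq p'q'; apply: leq_trans (size_polyMleq _ _) _.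
rewrite size_mul// -!subn1 leq_sub2r// leq_add//.
Qed.

(** The reduced denominator divides any other one ([rf_den_dvd]), and the
    difference of degrees between numerator and denominator does not depend on
    the representation. *)
Lemma stable_RHinf f : f \in stable_pred <->
  (rf_proper f /\ forall s : R[i], 0 <= complex.Re s -> ~ rf_pole f s).
Proof.
split=> [/stableP[p [q [fE hq pq]]]|[fp fs]]; last first.
  apply/stableP; exists (rf_num f), (rf_den f); split=> //; first exact: rf_numdenE.
  by move=> s s0; apply/negP => /fs; exact.
have q0 := hurwitz_neq0 hq; split; last first.
  move=> s s0; apply/negP; apply: (hurwitz_dvd hq) => //.
  by rewrite fE rf_den_dvd.
have d0 := rf_den_neq0 f.
have E : rf_num f * q = p * rf_den f.
  by apply/tofrac_eq_cross => //; rewrite -fE -rf_numdenE.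
rewrite /rf_proper; have [->|n0] := eqVneq (rf_num f) 0; first by rewrite size_poly0.
have p0 : p != 0.
  by apply: contraNneq n0 => p0; move/eqP: E; rewrite p0 mul0r mulf_eq0 (negPf q0) orbF.
have := congr1 (fun r : {poly R} => size r) E; rewrite !size_mul// => {}E.
have := size_poly_gt0 q; rewrite q0 => q1.
have := size_poly_gt0 p; rewrite p0 => p1.
have := size_poly_gt0 (rf_den f); rewrite d0 => d1.
move: E pq q1 p1 d1.
by move: (size _) (size _) (size p) (size q) => a b c d; lia.
Qed.

Lemma stable_closed : subring_closed stable_pred.
Proof.
split=> [|f g /stableP[p [q [-> hq pq]]] /stableP[p' [q' [-> hq' p'q']]]|
  f g /stableP[p [q [-> hq pq]]] /stableP[p' [q' [-> hq' p'q']]]]; apply/stableP.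
- by exists 1, 1; split; rewrite ?tofrac1 ?divr1//; exact: hurwitz1.
- have q0 := hurwitz_neq0 hq; have q'0 := hurwitz_neq0 hq'.
  exists (p * q' - p' * q), (q * q'); split; last first.
  + rewrite (leq_trans (size_polyD _ _))// geq_max size_polyN.
    by rewrite size_mul_proper// mulrC size_mul_proper.
  + exact: hurwitzM.
  by rewrite tofracB !tofracM -mulNr addf_div ?tofrac_eq0// mulNr.
- have q0 := hurwitz_neq0 hq; have q'0 := hurwitz_neq0 hq'.
  exists (p * p'), (q * q'); split; last exact: size_mul_proper.
  + by rewrite !tofracM mulf_div.
  exact: hurwitzM.
Qed.

HB.instance Definition _ :=
  GRing.isSubringClosed.Build {fraction {poly R}} stable_pred stable_closed.

Lemma stable_const (a : R) : tofrac a%:P \in stable_pred.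
Proof.
apply/stableP; exists a%:P, 1; split; rewrite ?tofrac1 ?divr1//.
  exact: hurwitz1.
by rewrite size_poly1 size_polyC leq_b1.
Qed.

Lemma rf_eval_frac p q (s : R[i]) : hurwitz q -> 0 <= complex.Re s ->
  rf_eval (tofrac p / tofrac q) s = (cpoly p).[s] / (cpoly q).[s].
Proof.
move=> hq s0; have q0 := hurwitz_neq0 hq.
have hd : hurwitz (rf_den (tofrac p / tofrac q)) := hurwitz_dvd hq (rf_den_dvd p q0).
have E := tofrac_eq_cross q0 (rf_den_neq0 _) (rf_numdenE (tofrac p / tofrac q)).
apply/eqP; rewrite /rf_eval eqr_div; [|exact: hd|exact: hq].
by rewrite -!hornerM -!cpolyM E.
Qed.

Lemma rf_evalD f g s : f \in stable_pred -> g \in stable_pred -> 0 <= complex.Re s ->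
  rf_eval (f + g) s = rf_eval f s + rf_eval g s.
Proof.
move=> /stableP[p [q [-> hq pq]]] /stableP[p' [q' [-> hq' p'q']]] s0.
have q0 := hurwitz_neq0 hq; have q'0 := hurwitz_neq0 hq'.
rewrite addf_div ?tofrac_eq0// -!tofracM -tofracD !rf_eval_frac//; last exact: hurwitzM.
rewrite /cpoly rmorphD/= !rmorphM/= hornerD !hornerM -addf_div//; [exact: hq|exact: hq'].
Qed.

Lemma rf_evalM f g s : f \in stable_pred -> g \in stable_pred -> 0 <= complex.Re s ->
  rf_eval (f * g) s = rf_eval f s * rf_eval g s.
Proof.
move=> /stableP[p [q [-> hq pq]]] /stableP[p' [q' [-> hq' p'q']]] s0.
rewrite mulf_div -!tofracM !rf_eval_frac//; last exact: hurwitzM.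
by rewrite !cpolyM !hornerM mulf_div.
Qed.

Lemma cvg_inv_imag : ((0 +i* w)^-1 : R[i]^o) @[w --> +oo%R] --> (0 : R[i]^o).
Proof.
apply/cvgr0Pnorm_lt => e e0.
have e0' : 0 < complex.Re e by move: e0; rewrite ltcE => /andP[].
have eE : e = (complex.Re e)%:C by rewrite RRe_real// gtr0_real.
near=> w.
have w0 : 0 < w by near: w; exact: nbhs_pinfty_gt.
rewrite normfV normc_def /= expr0n add0r sqrtr_sqr gtr0_norm// eE -fmorphV ltcR.
rewrite -[X in _ < X]invrK ltf_pV2 ?posrE ?invr_gt0//.
Unshelve. all: by end_near. Qed.

(** Horner's rule: dividing [p 'X + c] by one more power of the variable only adds
    the term [c / s ^ (D + 1)], which vanishes at infinity. *)
Lemma cvg_horner_imag p D : (size p <= D.+1)%N ->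
  ((cpoly p).[0 +i* w] / (0 +i* w) ^+ D : R[i]^o) @[w --> +oo%R]
    --> ((p`_D)%:C : R[i]^o).
Proof.
elim: D p => [|D IH] p.
  move=> /size1_polyC ->; rewrite coefC eqxx.
  under eq_fun do rewrite /cpoly map_polyC hornerC expr0 divr1.
  exact: cvg_cst.
elim/poly_ind: p => [|p c _ sz].
  move=> _; under eq_fun do rewrite /cpoly rmorph0 horner0 mul0r.
  rewrite coef0; exact: cvg_cst.
have szp : (size p <= D.+1)%N.
  by move: sz; rewrite size_MXaddC; case: ifP => [/andP[/eqP-> _]|]; rewrite ?size_poly0.
have -> : (p * 'X + c%:P)`_D.+1 = p`_D by rewrite coefD coefMX coefC addr0.
have zX k : (((0 +i* w)^-1 ^+ k.+1 : R[i]^o)) @[w --> +oo%R] --> (0 : R[i]^o).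
  elim: k => [|k IHk]; first exact: cvg_inv_imag.
  under eq_fun do rewrite exprS.
  have : ((0 +i* w)^-1 * (0 +i* w)^-1 ^+ k.+1 : R[i]^o) @[w --> +oo%R]
      --> (0 * 0 : R[i]^o) by apply: cvgM => //; exact: cvg_inv_imag.
  by rewrite mulr0.
have zXc : (c%:C * (0 +i* w)^-1 ^+ D.+1 : R[i]^o) @[w --> +oo%R] --> (0 : R[i]^o).
  have : (c%:C * (0 +i* w)^-1 ^+ D.+1 : R[i]^o) @[w --> +oo%R]
      --> (c%:C * 0 : R[i]^o) by apply: cvgM => //; exact: cvg_cst.
  by rewrite mulr0.
apply: (@cvg_trans _ (((cpoly p).[0 +i* w] / (0 +i* w) ^+ D +
   c%:C * (0 +i* w)^-1 ^+ D.+1 : R[i]^o) @[w --> +oo%R])).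
  apply: near_eq_cvg; near=> w.
  have w0 : (0 +i* w) != 0 :> R[i].
    by rewrite eq_complex /= eqxx /= gt_eqF//; near: w; exact: nbhs_pinfty_gt.
  rewrite /cpoly rmorphD rmorphM /= map_polyX map_polyC !hornerE mulrDl exprVn.
  by rewrite exprSr -mulf_div divff// mulr1.
have : ((cpoly p).[0 +i* w] / (0 +i* w) ^+ D + c%:C * (0 +i* w)^-1 ^+ D.+1
    : R[i]^o) @[w --> +oo%R] --> ((p`_D)%:C + 0 : R[i]^o).
  by apply: cvgD; [exact: IH|exact: zXc].
by rewrite addr0.
Unshelve. all: by end_near. Qed.

Lemma cvg_frac_imag p q : hurwitz q -> (size p <= size q)%N ->
  (rf_eval (tofrac p / tofrac q) (0 +i* w) : R[i]^o) @[w --> +oo%R]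
    --> ((p`_(size q).-1 / lead_coef q)%:C : R[i]^o).
Proof.
move=> hq pq; have q0 := hurwitz_neq0 hq.
have l0 : (lead_coef q)%:C != 0 :> R[i] by rewrite fmorph_eq0 lead_coef_eq0.
have sq : size q = (size q).-1.+1 by rewrite prednK// size_poly_gt0.
(* Dividing both polynomials by the same power of the variable leaves two
   limits that are finite, the second one being nonzero. *)
apply: (@cvg_trans _ ((((cpoly p).[0 +i* w] / (0 +i* w) ^+ (size q).-1) /
   ((cpoly q).[0 +i* w] / (0 +i* w) ^+ (size q).-1)  : R[i]^o) @[w --> +oo%R])).
  apply: near_eq_cvg; near=> w.
  have w0 : (0 +i* w) != 0 :> R[i].
    by rewrite eq_complex /= eqxx /= gt_eqF//; near: w; exact: nbhs_pinfty_gt.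
  rewrite rf_eval_frac// invfM invrK mulrACA.
  by rewrite mulVf ?mulr1// expf_neq0.
rewrite rmorphM fmorphV; apply: cvgM; first by apply: cvg_horner_imag; rewrite -sq.
by apply: cvgV => //; rewrite lead_coefE; apply: cvg_horner_imag; rewrite -sq.
Unshelve. all: by end_near. Qed.

Lemma rf_freq_cvg f : f \in stable_pred ->
  (rf_eval f (0 +i* w) : R[i]^o) @[w --> +oo%R] --> (rf_freq f +oo%E : R[i]^o).
Proof.
move=> /stableP[p [q [-> hq pq]]]; have := cvg_frac_imag hq pq => c.
by rewrite /rf_freq (cvg_lim _ c)//; exact: norm_hausdorff.
Qed.

Lemma rf_freq_pinfty p q : hurwitz q -> (size p <= size q)%N ->
  rf_freq (tofrac p / tofrac q) +oo%E = (p`_(size q).-1 / lead_coef q)%:C.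
Proof.
move=> hq pq; rewrite /rf_freq; apply: (@cvg_lim R[i]^o).
  exact: norm_hausdorff.
exact: cvg_frac_imag.
Qed.

(** On the stable fractions, evaluation at a frequency is a ring morphism; at
    infinity this is the compatibility of limits with the operations. *)
Lemma rf_freqD f g w : f \in stable_pred -> g \in stable_pred -> (0 <= w)%E ->
  rf_freq (f + g) w = rf_freq f w + rf_freq g w.
Proof.
case: w => [w| |//] fS gS _; first exact: rf_evalD.
rewrite [LHS]/rf_freq; apply: (@cvg_lim R[i]^o); first exact: norm_hausdorff.
under eq_fun do rewrite rf_evalD//.
by apply: cvgD; exact: rf_freq_cvg.
Qed.

Lemma rf_freqM f g w : f \in stable_pred -> g \in stable_pred -> (0 <= w)%E ->
  rf_freq (f * g) w = rf_freq f w * rf_freq g w.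
Proof.
case: w => [w| |//] fS gS _; first exact: rf_evalM.
rewrite [LHS]/rf_freq; apply: (@cvg_lim R[i]^o); first exact: norm_hausdorff.
under eq_fun do rewrite rf_evalM//.
by apply: cvgM; exact: rf_freq_cvg.
Qed.

Lemma rf_freqC (a : R) w : (0 <= w)%E -> rf_freq (tofrac a%:P) w = a%:C.
Proof.
have aE : tofrac a%:P = tofrac a%:P / tofrac 1 :> {fraction {poly R}}.
  by rewrite tofrac1 divr1.
rewrite aE; case: w => [w| |//] _; last first.
  rewrite rf_freq_pinfty ?size_poly1 ?size_polyC ?leq_b1//; last exact: hurwitz1.
  by rewrite coefC eqxx lead_coef1 divr1.
rewrite /= rf_eval_frac//; last exact: hurwitz1.
by rewrite /cpoly map_polyC rmorph1 !hornerE divr1.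
Qed.

End StableFractions.

(** * Determinants over stable fractions *)

(** A relation compatible with the ring operations passes to determinants. It
    serves for evaluation at a frequency, which is a ring morphism on the
    stable fractions only and therefore out of reach of [det_map_mx]. *)
Lemma det_ind2 (A B : comPzRingType) (K : A -> B -> Prop) k
    (M : 'M[A]_k) (M' : 'M[B]_k) :
  K 0 0 -> K 1 1 -> (forall a b a' b', K a a' -> K b b' -> K (a + b) (a' + b')) ->
  (forall a b a' b', K a a' -> K b b' -> K (a * b) (a' * b')) -> K (-1) (-1) ->
  (forall i j, K (M i j) (M' i j)) -> K (\det M) (\det M').
Proof.
move=> K0 K1 KD KM KN KMM; apply: big_ind2 => // [*|s _]; first exact: KD.
apply: (KM); last by apply: big_ind2 => // *; exact: KM.
by case: (perm.odd_perm s); rewrite ?expr1 ?expr0.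
Qed.

Section StableMatrices.
Variable R : realType.
Local Notation F := {fraction {poly R}}.
Local Notation S := (@stable_pred R).

(** The numerators are collected as the coefficients of a polynomial [P] over
    [{poly R}], so that evaluating [chi] at a real constant amounts to evaluating
    [P] at that constant, over the fixed denominator [d]. *)
Lemma common_denominator (chi : {poly F}) : chi \is a polyOver S ->
  exists (d : {poly R}) (P : {poly {poly R}}),
    [/\ hurwitz d, forall k, (size (P`_k)%R <= size d)%N
      & (tofrac d)%:P * chi = map_poly (@tofrac _) P].
Proof.
elim/poly_ind: chi => [|chi c IH] chiS.
  exists 1, 0; split; [exact: hurwitz1|by move=> k; rewrite coef0 size_poly0|].
  by rewrite mulr0 rmorph0.
have chiS' : chi \is a polyOver S.
  apply/polyOverP => k; move/polyOverP/(_ k.+1): chiS.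
  by rewrite coefD coefMX coefC addr0.
have /stableP[p [q [cE hq pq]]] : c \in S.
  by move/polyOverP/(_ 0): chiS; rewrite coefD coefMX coefC add0r.
have [d [P [hd Pd dP]]] := IH chiS'.
have q0 := hurwitz_neq0 hq; have d0 := hurwitz_neq0 hd.
exists (q * d), (q%:P * P * 'X + (p * d)%:P); split; first exact: hurwitzM.
  case=> [|k]; rewrite coefD coefMX coefC ?add0r ?addr0 /=.
    exact: size_mul_proper.
  by rewrite coefCM size_mul_proper.
have qc : tofrac (q * d) * c = tofrac (p * d).
  by rewrite cE [LHS]mulrC !tofracM mulrA divfK ?tofrac_eq0.
rewrite mulrDr -polyCM qc rmorphD /= map_polyC /=; congr (_ + _).
by rewrite tofracM polyCM !rmorphM /= map_polyX map_polyC /= -dP !mulrA.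
Qed.

Lemma pow_lipschitz k (s t : R) : 0 <= s <= 1 -> 0 <= t <= 1 ->
  `|t ^+ k - s ^+ k| <= k%:R * `|t - s|.
Proof.
move=> /andP[s0 s1] /andP[t0 t1].
elim: k => [|k IH]; first by rewrite subrr normr0 mul0r.
have -> : t ^+ k.+1 - s ^+ k.+1 = t * (t ^+ k - s ^+ k) + (t - s) * s ^+ k.
  by rewrite !exprS; ring.
rewrite -natr1 [leRHS]mulrDl mul1r (le_trans (ler_normD _ _))//.
rewrite !normrM lerD//.
  by apply: le_trans IH; rewrite ler_piMl// ger0_norm.
by rewrite ler_piMr// ger0_norm ?exprn_ge0// exprn_ile1.
Qed.

Lemma coef_horner_const (P : {poly {poly R}}) (t : R) i :
  (P.[t%:P])`_i = \sum_(k < size P) P`_k`_i * t ^+ k.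
Proof.
rewrite horner_coef coef_sum; apply: eq_bigr => k _.
by rewrite -rmorphXn coefMC.
Qed.

Lemma size_horner_const (P : {poly {poly R}}) (t : R) D :
  (forall k, (size (P`_k)%R <= D)%N) -> (size (P.[t%:P])%R <= D)%N.
Proof.
move=> PD; apply/leq_sizeP => i Di; rewrite coef_horner_const big1// => k _.
by rewrite (leq_sizeP _ _ (PD k))// mul0r.
Qed.

(** Each coefficient is a polynomial in the parameter; bounding [P`_k`_i] by the
    sum of the absolute values of all coefficients of [P`_k] makes the constant
    independent of [i]. *)
Lemma horner_const_lipschitz (P : {poly {poly R}}) : exists b, forall i (s t : R),
  0 <= s <= 1 -> 0 <= t <= 1 ->
  `|(P.[t%:P])`_i - (P.[s%:P])`_i| <= b * `|t - s|.
Proof.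
pose c k := \sum_(j < size P`_k) `|P`_k`_j|.
have cP k i : `|P`_k`_i| <= c k.
  have [ik|ki] := ltnP i (size P`_k); last first.
    by rewrite nth_default// normr0 sumr_ge0.
  by rewrite /c (bigD1 (Ordinal ik))//= lerDl sumr_ge0.
exists (\sum_(k < size P) c k * k%:R) => i s t s01 t01.
rewrite !coef_horner_const -sumrB (le_trans (ler_norm_sum _ _ _))//.
rewrite mulr_suml ler_sum// => k _.
by rewrite -mulrBr normrM -mulrA ler_pM// pow_lipschitz.
Qed.

Lemma stable_det k (M : 'M[F]_k) : (forall i j, M i j \in S) -> \det M \in S.
Proof.
move=> MS; rewrite rpred_sum// => s _.
by rewrite rpredM ?rpred_prod// rpredX// rpredN1.
Qed.

Lemma rf_freq_det k (M : 'M[F]_k) w : (0 <= w)%E -> (forall i j, M i j \in S) ->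
  rf_freq (\det M) w = \det (freq M w).
Proof.
move=> w0 MS.
have freqC (a : R) (f : F) : f = tofrac a%:P -> f \in S /\ rf_freq f w = a%:C.
  by move=> ->; rewrite stable_const rf_freqC.
pose K (f : F) (c : R[i]) := f \in S /\ rf_freq f w = c.
suff [] : K (\det M) (\det (freq M w)) by [].
apply: det_ind2.
- by apply: freqC; rewrite tofrac0.
- by apply: freqC; rewrite tofrac1.
- by move=> f g _ _ [fS <-] [gS <-]; split; [exact: rpredD|exact: rf_freqD].
- by move=> f g _ _ [fS <-] [gS <-]; split; [exact: rpredM|exact: rf_freqM].
- have <- : (-1)%:C = -1 :> R[i] by rewrite rmorphN1.
  by apply: freqC; rewrite polyCN tofracN tofrac1.
- by move=> i j; split=> //; rewrite mxE.
Qed.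

Lemma freq_mulmx k l h (M : 'M[F]_(k, l)) (M' : 'M[F]_(l, h)) w : (0 <= w)%E ->
  (forall i j, M i j \in S) -> (forall i j, M' i j \in S) ->
  freq (M *m M') w = freq M w *m freq M' w.
Proof.
move=> w0 MS MS'; apply/matrixP => i j; rewrite !mxE.
pose K (f : F) (c : R[i]) := f \in S /\ rf_freq f w = c.
suff [] : K (\sum_j0 M i j0 * M' j0 j) (\sum_j0 freq M w i j0 * freq M' w j0 j) by [].
apply: big_ind2.
- by rewrite /K rpred0 -tofrac0 -polyC0 rf_freqC.
- by move=> f _ g _ [fS <-] [gS <-]; split; [exact: rpredD|exact: rf_freqD].
- by move=> h0 _; rewrite !mxE; split; [exact: rpredM|exact: rf_freqM].
Qed.

(** The homotopy argument for a general stable matrix [A]: equality of the two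
    sizes expresses that the determinant is nonzero at infinity, so the
    determinant is a unit of the ring of stable fractions. *)
Lemma det_add1_frac k (A : 'M[F]_k) : (forall i j, A i j \in S) ->
  (forall w (t : R), (0 <= w)%E -> 0 <= t <= 1 ->
     \det (1%:M + t%:C *: freq A w) != 0) ->
  exists p d : {poly R}, [/\ \det (1%:M + A) = tofrac p / tofrac d,
    hurwitz p, hurwitz d & size p = size d].
Proof.
move=> AS Adet.
pose chi : {poly F} := \det (1%:M + 'X *: map_mx polyC A).
have chiS : chi \is a polyOver S.
  rewrite rpred_sum// => s _; rewrite rpredM ?rpredX ?rpredN1//.
  rewrite rpred_prod// => i _; rewrite !mxE rpredD ?rpred_nat//.
  by rewrite rpredM ?polyOverX ?polyOverC.
have chiE (t : F) : chi.[t] = \det (1%:M + t *: A).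
  rewrite -[LHS]/(horner_eval t chi) /chi -det_map_mx; congr (\det _).
  apply/matrixP => i j; rewrite !mxE.
  by rewrite rmorphD rmorphM rmorph_nat /= /horner_eval hornerX hornerC.
have [d [P [hd Pd dP]]] := common_denominator chiS.
have d0 := hurwitz_neq0 hd.
(* [Q t] is the numerator of [det (1 + t A)] over the denominator [d], which
   does not depend on [t]. *)
pose Q (t : R) := P.[t%:P].
have QE t : \det (1%:M + tofrac t%:P *: A) = tofrac (Q t) / tofrac d.
  apply: (mulfI (x := tofrac d)); first by rewrite tofrac_eq0.
  rewrite mulrCA divff ?tofrac_eq0// mulr1 -chiE -horner_map /= -dP.
  by rewrite hornerM hornerC.
have Qd t : (size (Q t) <= size d)%N by apply: size_horner_const.
have entS t i j : (1%:M + tofrac t%:P *: A) i j \in S.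
  by rewrite !mxE rpredD ?rpred_nat// rpredM// stable_const.
have freqE t w : (0 <= w)%E ->
    rf_freq (tofrac (Q t) / tofrac d) w = \det (1%:M + t%:C *: freq A w).
  move=> w0; rewrite -QE rf_freq_det//; congr (\det _); apply/matrixP => i j.
  rewrite !mxE rf_freqD//; first last.
  - by rewrite rpredM// stable_const.
  - by rewrite rpred_nat.
  rewrite rf_freqM ?stable_const// rf_freqC//; congr (_ + _).
  case: (i == j) => /=; rewrite ?mulr1n ?mulr0n.
    by rewrite -tofrac1 -polyC1 rf_freqC.
  by rewrite -tofrac0 -polyC0 rf_freqC.
(* A drop of degree would make the determinant vanish at infinity. *)
have Qsz t : 0 <= t <= 1 -> size (Q t) = (size d).-1.+1.
  move=> t01; rewrite prednK ?size_poly_gt0//; apply/eqP.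
  rewrite eqn_leq Qd leqNgt; apply/negP => Qlt.
  have := Adet +oo%E t le0y t01; rewrite -freqE// rf_freq_pinfty//.
  by rewrite nth_default ?mul0r ?eqxx// -ltnS prednK ?size_poly_gt0.
have Q0 : Q 0 = d.
  apply/eqP; rewrite -tofrac_eq; apply/eqP.
  have := QE 0; rewrite polyC0 tofrac0 scale0r addr0 det1.
  by move/(congr1 ( *%R^~ (tofrac d))); rewrite mul1r divfK ?tofrac_eq0.
have [b Qb] := horner_const_lipschitz P.
have hQ : hurwitz (Q 1).
  apply: (hurwitz_homotopy Qb Qsz) => [t w t01 w0|]; last by rewrite -/(Q 0) Q0.
  apply/negP => /rootP Qw.
  have := Adet w%:E t; rewrite lee_fin => /(_ w0 t01).
  by rewrite -freqE ?lee_fin//= rf_eval_frac// Qw mul0r eqxx.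
exists (Q 1), d; split=> //; first by rewrite -QE polyC1 tofrac1 scale1r.
by rewrite Qsz ?ler01 ?lexx// prednK// size_poly_gt0.
Qed.

Lemma invmx_RHinf k (L : 'M[F]_k) (p d : {poly R}) : (forall i j, L i j \in S) ->
  \det L = tofrac p / tofrac d -> hurwitz p -> hurwitz d -> size p = size d ->
  L \in unitmx /\ RHinf (invmx L).
Proof.
move=> LS detL hp hd pd.
have p0 := hurwitz_neq0 hp; have d0 := hurwitz_neq0 hd.
have detU : \det L != 0 by rewrite detL mulf_neq0 ?invr_eq0 ?tofrac_eq0.
have LU : L \in unitmx by rewrite unitmxE unitfE.
split=> // i j; apply/stable_RHinf.
rewrite /invmx LU !mxE rpredM//.
  by rewrite detL invf_div; apply/stableP; exists d, p; split; rewrite ?pd.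
rewrite rpredM ?rpredX ?rpredN1// stable_det// => i' j'.
by rewrite !mxE.
Qed.

End StableMatrices.

(** * The theorem *)

Theorem mainTheorem8 (R : realType) (m n : nat)
    (G : 'M[{fraction {poly R}}]_(m, n)) (K : 'M[{fraction {poly R}}]_(n, m))
    (hG : RHinf G) (hK : RHinf K)
    (hNM : exists (N : \bar R -> 'M[R[i]]_n) (M : \bar R -> 'M[R[i]]_m),
      Linf N /\ Linf M /\
      forall w : \bar R, (0 <= w)%E ->
        let Pi := block_mx (N w) 0 0 (M w) in
        [/\ N w = (N w) ^t* /\ loewner_le (N w) 0,
            M w = (M w) ^t* /\ loewner_le 0 (M w),
            loewner_lt
              (row_mx 1%:M (- (freq G w) ^t*) *m Pi
                 *m col_mx 1%:M (- freq G w)) 0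
          & loewner_le 0
              (row_mx ((freq K w) ^t*) 1%:M *m Pi
                 *m col_mx (freq K w) 1%:M)])
    (u : 'M[{fraction {poly R}}]_1) (hu : unitary_RHinf u) :
  let L : 'M[{fraction {poly R}}]_m := 1%:M + u 0 0 *: (G *m K) in
  L \in unitmx /\ RHinf (invmx L).
Proof.
move=> L; have [N [M [_ [_ hPi]]]] := hNM; have [uRH uU] := hu.
have GS i j : G i j \in @stable_pred R by apply/stable_RHinf; exact: hG.
have KS i j : K i j \in @stable_pred R by apply/stable_RHinf; exact: hK.
have uS : u 0 0 \in @stable_pred R by apply/stable_RHinf; exact: uRH.
have GKS i j : (G *m K) i j \in @stable_pred R.
  by rewrite mxE; apply: rpred_sum => k _; apply: rpredM; [exact: GS|exact: KS].
have AS i j : (u 0 0 *: (G *m K)) i j \in @stable_pred R.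
  by rewrite mxE; apply: rpredM; [exact: uS|exact: GKS].
have LS i j : L i j \in @stable_pred R.
  by rewrite mxE; apply: rpredD; [rewrite mxE rpred_nat|exact: AS].
have [||p [d [detL hp hd pd]]] := @det_add1_frac R m (u 0 0 *: (G *m K)) => //.
  move=> w t w0 t01.
  have -> : freq (u 0 0 *: (G *m K)) w =
      rf_freq (u 0 0) w *: (freq G w *m freq K w).
    rewrite -freq_mulmx//; apply/matrixP => i j.
    rewrite mxE [in LHS]mxE rf_freqM; [|exact: uS|exact: GKS|exact: w0].
    by rewrite [RHS]mxE [in RHS]mxE.
  have u1 : `|rf_freq (u 0 0) w| = 1.
    have /unitarymxP/matrixP/(_ 0 0) := uU w w0.
    rewrite !mxE big_ord1 !mxE -normCK => /eqP.
    rewrite sqrf_eq1 => /orP[/eqP//|/eqP e].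
    by have := normr_ge0 (rf_freq (u 0 0) w); rewrite e oppr_ge0 ler10.
  have [_ [_ hM] hGl hKl] := hPi w w0.
  rewrite scalerA; apply: (separation_det_neq0 hM hGl hKl).
  rewrite normrM u1 mulr1 normc_def /= expr0n addr0 sqrtr_sqr -[1]/(1%:C) lecR.
  by have /andP[t0 t1] := t01; rewrite ger0_norm.
exact: invmx_RHinf detL hp hd pd.
Qed.
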